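(* In the setting described in the context, for every $k\ge0$ and $\mathbf v\in\mathbb{R}^M$, $$h_k(\mathbf v)=\sum_{\alpha_1,\dots,\alpha_k}\lambda_{\alpha_1}\cdots\lambda_{\alpha_k}\int_{[-\pi,\pi]^k}\rho(\theta_1)\cdots\rho(\theta_k)\,\mathrm{d}\theta_1\cdots\mathrm{d}\theta_k\int_{\mathbb{R}^M}h_{0,U_k(\underline\alpha,\underline\theta)}\Big(\Gamma_k(\underline\alpha,\underline\theta)V_k^T(\underline\alpha,\underline\theta)\mathbf v+\big(I_M-\Gamma_k^2(\underline\alpha,\underline\theta)\big)^{1/2}\mathbf w\Big)e^{-\pi|\mathbf w|^2}\,\mathrm{d}\mathbf w,$$ where $h_{0,U}(\mathbf x):=h_0(U\mathbf x)$.
   Context: Let $M,N$ be positive integers, $\lambda_S,\lambda_R,\mu>0$, and $\rho$ a probability density on $[-\pi,\pi]$. Coordinates of $\mathbf z=(\mathbf v,\mathbf w)\in\mathbb{R}^M\times\mathbb{R}^N$ are indexed $1,\dots,M+N$. For a pair $\alpha=(i,j)$, $1\le i<j\le M+N$, and $\theta\in[-\pi,\pi]$, $r_\alpha(\theta)$ is the rotation of $\mathbb{R}^{M+N}$ in the $(i,j)$ coordinate plane such that $r_\alpha(\theta)^{-1}\mathbf z$ has $i$-th coordinate $z_i\cos\theta-z_j\sin\theta$, $j$-th coordinate $z_i\sin\theta+z_j\cos\theta$, other coordinates unchanged. Let $\Lambda=\lambda_SM/2+\lambda_RN/2+\mu M$ and set $\lambda_{(i,j)}=\lambda_S/(\Lambda(M-1))$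 if $1\le i<j\le M$, $\lambda_{(i,j)}=\lambda_R/(\Lambda(N-1))$ if $M+1\le i<j\le M+N$, and $\lambda_{(i,j)}=\mu/(\Lambda N)$ if $1\le i\le M<j\le M+N$ (so $\sum_\alpha\lambda_\alpha=1$). Let $h_0$ be a nonnegative function on $\mathbb{R}^M$ such that $h_0(\mathbf v)e^{-\pi|\mathbf v|^2}$ is a probability density, and let $P(\mathbf v,\mathbf w)=\mathbf v$. Define $$h_k(\mathbf v)=\sum_{\alpha_1,\dots,\alpha_k}\lambda_{\alpha_1}\cdots\lambda_{\alpha_k}\int_{[-\pi,\pi]^k}\rho(\theta_1)\cdots\rho(\theta_k)\,\mathrm{d}\underline\theta\int_{\mathbb{R}^N}(h_0\circ P)\Big(\big[\textstyle\prod_{l=1}^kr_{\alpha_l}(\theta_l)\big]^{-1}(\mathbf v,\mathbf w)\Big)e^{-\pi|\mathbf w|^2}\,\mathrm{d}\mathbf w,$$ the sums running over all pairs. Write $\big[\prod_{l=1}^kr_{\alpha_l}(\theta_l)\big]^{-1}=\begin{pmatrix}A_k&B_k\\C_k&D_k\end{pmatrix}$ with $A_k=A_k(\underline\alpha,\underline\theta)\in\mathbb{R}^{M\times M}$, $B_k\in\mathbb{R}^{M\times N}$, and let $A_k=U_k\Gamma_kV_k^T$ be a singular value decomposition with $U_k,V_k$ orthogonal $M\times M$ matrices and $\Gamma_k=\mathrm{diag}(\gamma_{k,1},\dots,\gamma_{k,M})$, $\gamma_{k,j}\in[0,1]$ (all depending on $\underline\alpha=(\alpha_1,\dots,\alpha_k)$,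 $\underline\theta=(\theta_1,\dots,\theta_k)$). *)

(* Defs.v *)
From HB Require Import structures.
From mathcomp Require Import all_boot all_order all_algebra.
From mathcomp Require Import all_classical all_reals all_analysis.
Set Implicit Arguments. Unset Strict Implicit. Unset Printing Implicit Defensive.
Import Order.TTheory GRing.Theory Num.Theory.
Import numFieldNormedType.Exports.
Local Open Scope classical_set_scope.
Local Open Scope ring_scope.

Section Defs.
Variable R : realType.

(* Iterated Lebesgue integral over D^n (D ⊆ R) of a function of a column
   vector x = (x_0, ..., x_{n-1}); the first coordinate is integrated last
   (outermost).  For nonnegative Borel functions this is (Tonelli) the
   integral w.r.t. n-dimensional Lebesgue measure restricted to D^n. *)
Fixpoint iter_int (D : set R) (n : nat) : ('cV[R]_n -> \bar R) -> \bar R :=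
  match n with
  | 0 => fun f => f 0
  | n'.+1 => fun f =>
      (\int[@lebesgue_measure R]_(x in D)
         iter_int D (fun v : 'cV[R]_n' => f (col_mx (const_mx x : 'cV[R]_1) v)))%E
  end.

Definition sqnorm n (v : 'cV[R]_n) : R := \sum_(i < n) v i 0 ^+ 2.

Definition gweight n (v : 'cV[R]_n) : R := expR (- pi * sqnorm v).

Definition borel_cV n : set (set 'cV[R]_n) := <<s [set U | open U] >>.

Definition pair_t n := ('I_n * 'I_n)%type.
Definition is_pair n (a : pair_t n) : bool := (a.1 < a.2)%N.

Definition rot_inv n (a : pair_t n) (t : R) : 'M[R]_n :=
  \matrix_(p < n, q < n)
    if (p == a.1) && (q == a.1) then cos t
    else if (p == a.1) && (q == a.2) then - sin t
    else if (p == a.2) && (q == a.1) then sin t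
    else if (p == a.2) && (q == a.2) then cos t
    else if p == q then 1 else 0.

Definition rot n (a : pair_t n) (t : R) : 'M[R]_n := invmx (rot_inv a t).

Definition prod_rot_inv (M N k : nat) (a : {ffun 'I_k -> pair_t (M + N)})
  (t : 'cV[R]_k) : 'M[R]_(M + N) :=
  invmx (\big[mulmx/1%:M]_(l < k) rot (a l) (t l 0)).

Definition A_blk (M N k : nat) a t : 'M[R]_M := ulsubmx (@prod_rot_inv M N k a t).

Definition Lam (M N : nat) (lS lR mu : R) : R :=
  lS * M%:R / 2 + lR * N%:R / 2 + mu * M%:R.

Definition lam (M N : nat) (lS lR mu : R) (a : pair_t (M + N)) : R :=
  if (a.2 < M)%N then lS / (Lam M N lS lR mu * (M%:R - 1))
  else if (M <= a.1)%N then lR / (Lam M N lS lR mu * (N%:R - 1))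
  else mu / (Lam M N lS lR mu * N%:R).

Definition h_k (M N : nat) (lS lR mu : R) (rho : R -> R) (h0 : 'cV[R]_M -> R)
  (k : nat) (v : 'cV[R]_M) : \bar R :=
  (\sum_(a : {ffun 'I_k -> pair_t (M + N)} | [forall l, is_pair (a l)])
     (\prod_(l < k) lam lS lR mu (a l))%:E *
     iter_int `[(- pi)%R, pi%R] (fun t : 'cV[R]_k =>
        (\prod_(l < k) rho (t l 0))%:E *
        iter_int setT (fun w : 'cV[R]_N =>
          (h0 (usubmx (prod_rot_inv a t *m col_mx v w)) * gweight w)%:E)))%E.

End Defs.

(* Main.v *)
(* Fix the rotations and write A, B for the upper blocks of their product. As
   this product is orthogonal, B B^T = 1 - A A^T, so U^T B has Gram matrix
   1 - Gamma^2 and the two inner integrals are Gaussian averages of one function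
   along the linear maps U^T B and (1 - Gamma^2)^(1/2). Both maps factor through
   a matrix T : R^(M+N) -> R^M with orthonormal rows, and the Gaussian average
   along T is the one over R^M; this last fact follows from the linear change of
   variables, obtained by factoring an invertible matrix into block shears. *)

Require Import Defs.
From HB Require Import structures.
From mathcomp Require Import all_boot all_order all_algebra.
From mathcomp Require Import all_classical all_reals all_analysis.
From mathcomp Require Import measurable_realfun ring.
Import Order.TTheory GRing.Theory Num.Theory.
Import numFieldNormedType.Exports.
Local Open Scope classical_set_scope.
Local Open Scope ring_scope.

Set Implicit Arguments.
Unset Strict Implicit.
Unset Printing Implicit Defensive.

(** * Iterated Lebesgue integrals: affine substitution, measurability, Tonelli, translation *)

Section IteratedIntegral.
Context {R : realType}.
Local Notation mu := (@lebesgue_measure R).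

(** The pushforward of Lebesgue measure under [x => a * x + b], scaled by [|a|], agrees with
    Lebesgue measure on half-open intervals, hence on all measurable sets. *)
Lemma ge0_integral_affine (f : R -> \bar R) (a b : R) : a != 0 ->
  measurable_fun [set: R] f -> (forall x, 0 <= f x)%E ->
  (\int[mu]_x f (a * x + b)%R = `|a|^-1%:E * \int[mu]_x f x)%E.
Proof.
move=> a0 mf f0.
pose phi : measurableTypeR R -> measurableTypeR R := fun x => a * x + b.
have mphi : measurable_fun setT phi.
  by apply: measurable_funD => //; exact: measurable_funM.
have a_ge0 : 0 <= `|a| by [].
pose nu : {measure set (measurableTypeR R) -> \bar R} :=
  mscale (NngNum a_ge0) (pushforward mu phi).
have E A : measurable A -> mu A = nu mphi A.
  apply: lebesgue_measure_unique => _ [[c d] _ <-].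
  have -> : nu mphi `]c, d]%classic = (`|a|%:E * mu (phi @^-1` `]c, d]%classic))%E by [].
  have [ap|an] := ltP 0 a.
    have pE : phi @^-1` `]c, d]%classic = `](c - b) / a, (d - b) / a]%classic.
      apply/seteqP; split => x /=; rewrite !in_itv/= /phi ltr_pdivrMr// ler_pdivlMr//;
        by rewrite ltrBlDr lerBrDr (mulrC x).
    rewrite pE !lebesgue_measure_itv/= !lte_fin ltr_pM2r ?invr_gt0// ltrD2r.
    case: ifP; rewrite ?mule0// -?EFinB -?EFinM => _; congr EFin.
    by rewrite gtr0_norm//; field.
  have {}an : a < 0 by rewrite lt_neqAle a0.
  (* A negative slope exchanges the open and the closed end; the length is unaffected. *)
  have pE : phi @^-1` `]c, d]%classic = `[(d - b) / a, (c - b) / a[%classic.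
    apply/seteqP; split => x /=; rewrite !in_itv/= /phi ltr_ndivlMr// ler_ndivrMr//;
      by rewrite ltrBlDr lerBrDr (mulrC x) andbC.
  rewrite pE !lebesgue_measure_itv/= !lte_fin ltr_nM2r ?invr_lt0// ltrD2r.
  case: ifP; rewrite ?mule0// -?EFinB -?EFinM => _; congr EFin.
  by rewrite ltr0_norm//; field.
have := @ge0_integral_pushforward _ _ _ _ R phi mphi mu setT f measurableT mf (fun y _ => f0 y).
rewrite preimage_setT /comp => <-.
rewrite [X in (_ = _ * X)%E](eq_measure_integral (nu mphi)); last by move=> *; exact: E.
rewrite ge0_integral_mscale//= muleA -EFinM mulVf ?mul1e//.
by rewrite normr_eq0.
Qed.

Definition coord_measurable {d} {T : measurableType d} {n} (u : T -> 'cV[R]_n) :=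
  forall i, measurable_fun setT (fun x => u x i 0).

(* Borel measurability on column vectors is tested along coordinatewise
   measurable maps, so that no sigma-algebra on ['cV_n] is needed. *)
Definition jmeasurable {d} {T : measurableType d} {n} (F : T -> 'cV[R]_n -> \bar R) :=
  forall d' (T' : measurableType d') (p : T' -> T) (u : T' -> 'cV[R]_n),
    measurable_fun setT p -> coord_measurable u ->
    measurable_fun setT (fun x => F (p x) (u x)).

Definition vmeasurable {n} (f : 'cV[R]_n -> \bar R) :=
  forall d (T : measurableType d) (u : T -> 'cV[R]_n),
    coord_measurable u -> measurable_fun setT (f \o u).

Lemma coord_measurable_cst d (T : measurableType d) n (b : 'cV[R]_n) :
  coord_measurable (fun _ : T => b).
Proof. by move=> i. Qed.

Lemma coord_measurableD d (T : measurableType d) n (u v : T -> 'cV[R]_n) :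
  coord_measurable u -> coord_measurable v ->
  coord_measurable (fun x => u x + v x).
Proof.
move=> mu_ mv i; rewrite (_ : (fun _ => _) = (fun x => u x i 0) \+ (fun x => v x i 0)).
  exact: measurable_funD.
by apply/funext => x; rewrite mxE.
Qed.

Lemma coord_measurableM d (T : measurableType d) m n (A : 'M[R]_(m, n)) (u : T -> 'cV[R]_n) :
  coord_measurable u -> coord_measurable (fun x => A *m u x).
Proof.
move=> mu_ i; rewrite (_ : (fun _ => _) = (fun x => \sum_j A i j * u x j 0)).
  by apply: measurable_sum => j; apply: measurable_funM.
by apply/funext => x; rewrite mxE.
Qed.

Lemma coord_measurable_col d (T : measurableType d) m n
    (u : T -> 'cV[R]_m) (v : T -> 'cV[R]_n) :
  coord_measurable u -> coord_measurable v ->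
  coord_measurable (fun x => col_mx (u x) (v x)).
Proof.
move=> mu_ mv i; have [j ->|j ->] := split_ordP i.
- by rewrite (_ : (fun _ => _) = (fun x => u x j 0))//; apply/funext => x; rewrite col_mxEu.
- by rewrite (_ : (fun _ => _) = (fun x => v x j 0))//; apply/funext => x; rewrite col_mxEd.
Qed.

Lemma coord_measurable_const_mx d (T : measurableType d) n (p : T -> R) :
  measurable_fun setT p -> coord_measurable (fun x => const_mx (p x) : 'cV[R]_n).
Proof.
by move=> mp i; rewrite (_ : (fun _ => _) = p)//; apply/funext => x; rewrite mxE.
Qed.

Lemma iter_int_ge0 (D : set R) n (f : 'cV[R]_n -> \bar R) :
  (forall v, 0 <= f v)%E -> (0 <= iter_int D f)%E.
Proof. by elim: n f => //= n IH f f0; apply: integral_ge0 => x _; exact: IH. Qed.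

(** Agreement is required on [D^n] only, because a singular value decomposition is given only for
    angles in [[-pi, pi]]. *)
Lemma eq_iter_int (D : set R) n (f g : 'cV[R]_n -> \bar R) :
  (forall v : 'cV[R]_n, (forall i, v i 0 \in D) -> f v = g v) -> iter_int D f = iter_int D g.
Proof.
elim: n f g => [|n IH] f g fg /=; first by apply: fg => -[].
apply: eq_integral => x xD; apply: IH => v vD; apply: fg => i.
have [j ->|j ->] := split_ordP (i : 'I_(1 + n)).
  by rewrite (col_mxEu (const_mx x : 'cV_1)) mxE.
by rewrite (col_mxEd (const_mx x : 'cV_1)).
Qed.

Lemma jmeasurable_cons d (T : measurableType d) n (F : T -> 'cV[R]_n.+1 -> \bar R) :
  jmeasurable F ->
  jmeasurable (fun (z : T * R) (v : 'cV[R]_n) => F z.1 (col_mx (const_mx z.2 : 'cV_1) v)).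
Proof.
move=> mF d' T' p u mp mu_.
apply: (mF _ _ (fst \o p) (fun x => col_mx (const_mx (p x).2 : 'cV_1) (u x))).
  exact: measurableT_comp.
apply: (coord_measurable_col (m := 1)) => //; apply: coord_measurable_const_mx.
exact: measurableT_comp.
Qed.

(** The induction moves the outermost coordinate into the parameter space, which grows from [T] to
    [T * R]; Tonelli then integrates it out. *)
Lemma measurable_iter_int d (T : measurableType d) n (F : T -> 'cV[R]_n -> \bar R) :
  jmeasurable F -> (forall x v, 0 <= F x v)%E ->
  measurable_fun setT (fun x => iter_int setT (F x)).
Proof.
elim: n d T F => [|n IH] d T F mF F0 /=.
  exact: (mF _ _ id (fun=> 0)).
have := IH _ (T * measurableTypeR R)%type _ (jmeasurable_cons mF) (fun z v => F0 _ _).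
by move=> /(measurable_fun_fubini_tonelli_F (m2 := mu)); apply => z; exact: iter_int_ge0.
Qed.

Lemma jmeasurable_slice d (T : measurableType d) n (F : T -> 'cV[R]_n -> \bar R) x :
  jmeasurable F -> vmeasurable (F x).
Proof.
move=> mF d' T' u mu_; rewrite /comp.
exact: (mF _ _ (fun=> x) u (measurable_cst x) mu_).
Qed.

Lemma vmeasurable_cons n (f : 'cV[R]_n.+1 -> \bar R) :
  vmeasurable f ->
  jmeasurable (fun (x : R) (v : 'cV[R]_n) => f (col_mx (const_mx x : 'cV_1) v)).
Proof.
move=> mf d T p u mp mu_.
apply: (mf _ _ (fun x => col_mx (const_mx (p x) : 'cV_1) (u x))).
by apply: (coord_measurable_col (m := 1)) => //; exact: coord_measurable_const_mx.
Qed.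

Lemma jmeasurable_int d (T : measurableType d) n (F : R -> T -> 'cV[R]_n -> \bar R) :
  jmeasurable (fun z : R * T => F z.1 z.2) -> (forall x t v, 0 <= F x t v)%E ->
  jmeasurable (fun t v => \int[mu]_x F x t v)%E.
Proof.
move=> mF F0 d' T' p u mp mu_.
pose G (z : measurableTypeR R * T') := F z.1 (p z.2) (u z.2).
have mG : measurable_fun setT G.
  apply: (mF _ _ (fun z : measurableTypeR R * T' => (z.1, p z.2)) (fun z => u z.2)).
    apply: measurable_fun_pair; first exact: measurable_fst.
    exact: (measurableT_comp mp measurable_snd).
  by move=> i; exact: (measurableT_comp (mu_ i) measurable_snd).
by have /= := measurable_fun_fubini_tonelli_G (m1 := mu) G mG (fun z => F0 _ _ _).
Qed.

(** Two-variable Tonelli moves [x] past the first coordinate [y]; the induction hypothesis, with [y]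
    frozen, moves it past the others. *)
Lemma iter_int_tonelli n (F : R -> 'cV[R]_n -> \bar R) :
  jmeasurable F -> (forall x v, 0 <= F x v)%E ->
  (\int[mu]_x iter_int setT (F x) = iter_int setT (fun v => \int[mu]_x F x v))%E.
Proof.
elim: n F => [//|n IH] F mF F0 /=.
have mF2 := measurable_iter_int (jmeasurable_cons mF) (fun z v => F0 _ _).
have := fubini_tonelli (m1 := mu) (m2 := mu) _ mF2 (fun z => iter_int_ge0 _ (fun v => F0 _ _)).
move=> /= ->.
apply: eq_integral => y _; apply: (IH (fun x v => F x (col_mx (const_mx y : 'cV_1) v))) => //.
move=> d T p u mp mu_; apply: (mF _ _ p (fun z => col_mx (const_mx y : 'cV_1) (u z))) => //.
by apply: (coord_measurable_col (m := 1)) => //; exact: coord_measurable_cst.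
Qed.

(** The scalar is an extended real because it will be an integral whose finiteness is not known
    beforehand. *)
Lemma iter_intZl n (k : \bar R) (f : 'cV[R]_n -> \bar R) : (0 <= k)%E ->
  vmeasurable f -> (forall v, 0 <= f v)%E ->
  (iter_int setT (fun v => k * f v) = k * iter_int setT f)%E.
Proof.
move=> k0; elim: n f => [//|n IH] f mf f0 /=.
have mfx := vmeasurable_cons mf.
rewrite -ge0_integralZl//.
- by apply: eq_integral => x _; apply: IH => //; exact: (jmeasurable_slice x mfx).
- exact: (measurable_iter_int mfx).
- by move=> x _; exact: iter_int_ge0.
Qed.

Lemma iter_int_translation n (b : 'cV[R]_n) (f : 'cV[R]_n -> \bar R) :
  vmeasurable f -> (forall v, 0 <= f v)%E ->
  iter_int setT (fun v => f (v + b)) = iter_int setT f.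
Proof.
elim: n b f => [|n IH] b f mf f0 /=; first by congr f; apply/matrixP => -[].
have mfx := vmeasurable_cons mf.
pose G x := iter_int setT (fun v : 'cV[R]_n => f (col_mx (const_mx x : 'cV_1) v)).
transitivity (\int[mu]_x G (1 * x + b 0 0)%R)%E; last first.
  rewrite ge0_integral_affine ?oner_neq0//; last 2 first.
  - exact: (measurable_iter_int mfx).
  - by move=> x; exact: iter_int_ge0.
  by rewrite normr1 invr1 mul1e.
apply: eq_integral => x _; rewrite /G mul1r.
rewrite -[RHS](IH (dsubmx (b : 'cV_(1 + n))))//; last exact: (jmeasurable_slice _ mfx).
congr iter_int; apply/funext => v; congr f.
apply/matrixP => i j; rewrite [LHS]mxE !ord1.
have [k ->|k ->] := split_ordP (i : 'I_(1 + n)).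
  by rewrite !(@col_mxEu _ 1) !mxE ord1; congr (_ + b _ _); apply/val_inj.
by rewrite !(@col_mxEd _ 1) !mxE.
Qed.

Lemma vmeasurable_affine m n (A : 'M[R]_(m, n)) (b : 'cV[R]_m) (f : 'cV[R]_m -> \bar R) :
  vmeasurable f -> vmeasurable (fun v => f (A *m v + b)).
Proof.
move=> mf d T u mu_; apply: (mf _ _ (fun x => A *m u x + b)).
by apply: coord_measurableD; [exact: coord_measurableM|exact: coord_measurable_cst].
Qed.

Lemma vmeasurable_lin m n (A : 'M[R]_(m, n)) (f : 'cV[R]_m -> \bar R) :
  vmeasurable f -> vmeasurable (fun v => f (A *m v)).
Proof.
move=> mf d T u mu_; apply: (mf _ _ (fun x => A *m u x)).
exact: coord_measurableM.
Qed.

End IteratedIntegral.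

(** * Invertible linear changes of variables *)

Section LinearChange.
Context {R : realType}.

(** For invertible [A] the constant is [|det A|^-1]; keeping it existential avoids following
    determinants through the factorisation. *)
Definition scales_iter_int {n} (A : 'M[R]_n) := exists2 c : R, 0 < c &
  forall f : 'cV[R]_n -> \bar R, vmeasurable f -> (forall v, 0 <= f v)%E ->
    (iter_int setT (fun v => f (A *m v)) = c%:E * iter_int setT f)%E.

Lemma scales_iter_intM n (A B : 'M[R]_n) :
  scales_iter_int A -> scales_iter_int B -> scales_iter_int (A *m B).
Proof.
move=> [c c0 cA] [d d0 dB]; exists (c * d); first exact: mulr_gt0.
move=> f mf f0; rewrite [c * d]mulrC EFinM -muleA -cA// -dB//; last exact: vmeasurable_lin.
by congr iter_int; apply/funext => v; rewrite mulmxA.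
Qed.

(** Brings the image vector back to the shape from which [iter_int] peels its first coordinate. *)
Lemma mul_block_cons n (a : R) (r : 'rV[R]_n) (c : 'cV[R]_n) (S : 'M[R]_n) x (v : 'cV[R]_n) :
  block_mx a%:M r c S *m col_mx (const_mx x : 'cV_1) v =
  col_mx (const_mx (a * x + (r *m v) 0 0) : 'cV_1) (S *m v + x *: c) :> 'cV_(1 + n).
Proof.
rewrite mul_block_col; congr col_mx.
  by apply/matrixP => i j; rewrite !ord1 mul_scalar_mx !mxE.
rewrite addrC; congr (_ + _); apply/matrixP => i j.
by rewrite !mxE big_ord1 !mxE (ord1 j) mulrC.
Qed.

(** For a fixed outer variable [x], the shear translates the inner variables by [x *: c]. *)
Lemma scales_iter_int_lower n (c : 'cV[R]_n) :
  scales_iter_int (block_mx 1%:M 0 c 1%:M : 'M[R]_(1 + n)).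
Proof.
exists 1 => // f mf f0; rewrite mul1e /=.
have mfx := vmeasurable_cons mf.
apply: eq_integral => x _.
rewrite -[RHS](iter_int_translation (x *: c))//; last exact: (jmeasurable_slice _ mfx).
congr iter_int; apply/funext => v.
by rewrite (mul_block_cons 1) mul0mx mxE addr0 mul1r mul1mx.
Qed.

Lemma scales_iter_int_diag n (S : 'M[R]_n) : scales_iter_int S ->
  scales_iter_int (block_mx 1%:M 0 0 S : 'M[R]_(1 + n)).
Proof.
move=> [c c0 cS]; exists c => // f mf f0 /=.
have mfx := vmeasurable_cons mf.
rewrite -ge0_integralZl_EFin ?ltW//; last 2 first.
- by move=> x _; exact: iter_int_ge0.
- exact: (measurable_iter_int mfx).
apply: eq_integral => x _; rewrite -cS//; last exact: (jmeasurable_slice _ mfx).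
congr iter_int; apply/funext => v.
by rewrite (mul_block_cons 1) mul0mx mxE addr0 mul1r scaler0 addr0.
Qed.

(** Once Tonelli makes the first coordinate innermost, the map is affine in it with slope [a], the
    other coordinates being fixed. *)
Lemma scales_iter_int_upper n (a : R) (r : 'rV[R]_n) : a != 0 ->
  scales_iter_int (block_mx a%:M r 0 1%:M : 'M[R]_(1 + n)).
Proof.
move=> a0; exists `|a|^-1; first by rewrite invr_gt0 normr_gt0.
move=> f mf f0 /=.
have mfx := vmeasurable_cons mf.
have mg := vmeasurable_cons (vmeasurable_lin (block_mx a%:M r 0 1%:M : 'M[R]_(1 + n)) mf).
rewrite iter_int_tonelli// iter_int_tonelli// -iter_intZl ?lee_fin ?invr_ge0//; last 2 first.
(* The integrand carries no parameter besides [x], so [unit] serves as a dummy parameter space. *)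
- have := @jmeasurable_int R _ unit n (fun x _ v => f (col_mx (const_mx x : 'cV_1) v)).
  move=> /(_ _ _)/(jmeasurable_slice tt); apply => //.
  by move=> d T p u mp; apply: mfx; exact: measurableT_comp.
- by move=> v; apply: integral_ge0.
congr iter_int; apply/funext => v.
rewrite -(ge0_integral_affine ((r *m v) 0 0) a0)//; last first.
  by apply: (mfx _ _ id (fun=> v)) => // i; exact: measurable_cst.
apply: eq_integral => x _; congr f.
by rewrite mul_block_cons scaler0 addr0 mul1mx.
Qed.

(** Gaussian elimination with pivot [a]: the matrix is a lower shear times a diagonal block times an
    upper block. The Schur complement [S'] inherits invertibility, so the hypothesis in dimension
    [n] applies to it. *)
Lemma scales_iter_int_pivot n (a : R) (r : 'rV[R]_n) (c : 'cV[R]_n) (S : 'M[R]_n) :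
  (forall S : 'M[R]_n, S \in unitmx -> scales_iter_int S) ->
  a != 0 -> block_mx a%:M r c S \in unitmx ->
  scales_iter_int (block_mx a%:M r c S : 'M[R]_(1 + n)).
Proof.
move=> IH a0; pose S' := S - a^-1 *: (c *m r).
have -> : block_mx a%:M r c S = block_mx 1%:M 0 (a^-1 *: c) 1%:M *m
    (block_mx 1%:M 0 0 S' *m block_mx a%:M r 0 1%:M).
  rewrite !mulmx_block !(mul1mx, mulmx1, mul0mx, mulmx0, addr0, add0r).
  congr block_mx; first by rewrite mul_mx_scalar scalerA divff// scale1r.
  by rewrite /S' -scalemxAl addrC subrK.
rewrite unitmx_mul => /andP[_]; rewrite unitmx_mul => /andP[].
rewrite unitmxE det_ublock det1 mul1r -unitmxE => /IH uS _.
apply: scales_iter_intM; first exact: scales_iter_int_lower.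
by apply: scales_iter_intM; [exact: scales_iter_int_diag|exact: scales_iter_int_upper].
Qed.

Lemma scales_iter_int_unitmx n (A : 'M[R]_n) : A \in unitmx -> scales_iter_int A.
Proof.
elim: n A => [|n IH] A uA.
  by exists 1 => // f _ _ /=; rewrite mul1e; congr f; apply/matrixP => -[].
pose B : 'M[R]_(1 + n) := A; rewrite -[A]/B.
have {uA} : B \in unitmx by [].
rewrite -[B]submxK [ulsubmx B]mx11_scalar.
move: (ulsubmx B 0 0) (ursubmx B) (dlsubmx B) (drsubmx B) => a r c S uB.
have [a0|a0] := eqVneq a 0; last exact: scales_iter_int_pivot.
(* With a zero corner, invertibility forces a nonzero entry below it. Adding that row to the first
   one, through [P 1], makes [c i 0] the new pivot, and [P (-1)] undoes the operation. *)
have [i ci] : exists i, c i 0 != 0.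
  apply/existsP; rewrite -negb_forall; apply/negP => /forallP c0.
  move: uB; rewrite (_ : c = 0) ?a0; last first.
    by apply/matrixP => i j; rewrite ord1 mxE; apply/eqP.
  by rewrite unitmxE det_ublock det_scalar expr1 mul0r unitr0.
pose P (s : R) : 'M[R]_(1 + n) := block_mx 1%:M (s *: delta_mx 0 i) 0 1%:M.
have PE : block_mx a%:M r c S = P (-1) *m (P 1 *m block_mx a%:M r c S).
  rewrite mulmxA mulmx_block !(mul1mx, mulmx1, mul0mx, mulmx0, addr0, add0r).
  by rewrite scale1r scaleN1r subrr -scalar_mx_block mul1mx.
rewrite PE; apply: scales_iter_intM; first exact/scales_iter_int_upper/oner_neq0.
have uP s : P s \in unitmx by rewrite unitmxE det_ublock !det1 mulr1 unitr1.
have : P 1 *m block_mx a%:M r c S \in unitmx by rewrite unitmx_mul uP.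
rewrite mulmx_block [X in block_mx X _ _ _]mx11_scalar; apply: scales_iter_int_pivot => //.
by rewrite a0 mul1mx scale1r -rowE !mxE /= mul0rn add0r.
Qed.

End LinearChange.

(** * Gaussian integrals and their marginals *)

Section GaussianIntegral.
Context {R : realType}.
Local Notation mu := (@lebesgue_measure R).

Lemma sqnorm_col m n (u : 'cV[R]_m) (v : 'cV[R]_n) :
  sqnorm (col_mx u v) = sqnorm u + sqnorm v.
Proof.
rewrite /sqnorm big_split_ord /=; congr (_ + _); apply: eq_bigr => i _.
- by rewrite col_mxEu.
- by rewrite col_mxEd.
Qed.

Lemma sqnormE n (v : 'cV[R]_n) : sqnorm v = (v^T *m v) 0 0.
Proof. by rewrite mxE; apply: eq_bigr => i _; rewrite mxE expr2. Qed.

Lemma gweight_col m n (u : 'cV[R]_m) (v : 'cV[R]_n) :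
  gweight (col_mx u v) = gweight u * gweight v.
Proof. by rewrite /gweight sqnorm_col mulrDr expRD. Qed.

Lemma gweight_ge0 n (v : 'cV[R]_n) : 0 <= gweight v.
Proof. exact: expR_ge0. Qed.

Lemma vmeasurable_gweight n : vmeasurable (fun v : 'cV[R]_n => (gweight v)%:E).
Proof.
move=> d T u mu_; apply/measurable_EFinP.
change (measurable_fun setT (expR \o (fun x => - pi * sqnorm (u x)))).
apply: measurableT_comp => //; apply: measurable_funM => //.
by apply: measurable_sum => i; apply: measurable_funX.
Qed.

Lemma vmeasurableM n (f g : 'cV[R]_n -> \bar R) :
  vmeasurable f -> vmeasurable g -> vmeasurable (fun v => f v * g v)%E.
Proof.
by move=> mf mg d T u mu_; apply: emeasurable_funM; [exact: mf|exact: mg].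
Qed.

Lemma iter_int_split m n (f : 'cV[R]_(m + n) -> \bar R) :
  iter_int setT f =
  iter_int setT (fun u : 'cV[R]_m => iter_int setT (fun v : 'cV[R]_n => f (col_mx u v))).
Proof.
elim: m f => [|m IH] f /=.
  congr iter_int; apply/funext => v; congr f.
  apply/matrixP => i j; have [[]//|k ->] := split_ordP (i : 'I_(0 + n)).
  by rewrite col_mxEd; congr (v _ _); apply/val_inj.
apply: eq_integral => x _; rewrite (IH (fun v => f (col_mx (const_mx x : 'cV_1) v))).
congr iter_int; apply/funext => u; congr iter_int; apply/funext => v; congr f.
(* The two nested [col_mx] bracket the dimensions differently, so they are compared entry by entry,
   through the values of the indices. *)
apply/matrixP => i j.
have [k ->|k ->] := split_ordP (i : 'I_(m.+1 + n)).
  rewrite [RHS]col_mxEu; have [l ->|l ->] := split_ordP (k : 'I_(1 + m)).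
    rewrite (@col_mxEu _ 1) -(@col_mxEu _ 1 (m + n) _ _ (col_mx u v)).
    by congr (col_mx _ _ _ _); apply/val_inj.
  rewrite (@col_mxEd _ 1) -(@col_mxEu _ m n _ u v).
  rewrite -(@col_mxEd _ 1 (m + n) _ (const_mx x) (col_mx u v)).
  by congr (col_mx _ _ _ _); apply/val_inj.
rewrite [RHS]col_mxEd -(@col_mxEd _ m n _ u v).
rewrite -(@col_mxEd _ 1 (m + n) _ (const_mx x) (col_mx u v)).
by congr (col_mx _ _ _ _); apply/val_inj; rewrite /= addnA.
Qed.

Lemma integral_gauss_pi : (\int[mu]_x (expR (- pi * x ^+ 2))%:E = 1)%E.
Proof.
(* This standard deviation makes the normal density equal to [expR (- pi * x ^+ 2)], with peak value
   1. *)
pose s : R := (Num.sqrt (pi *+ 2))^-1.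
have p2 : 0 < (pi *+ 2 : R) by rewrite mulrn_wgt0// pi_gt0.
have s0 : s != 0 by rewrite invr_neq0// gt_eqF// sqrtr_gt0.
have s2 : s ^+ 2 = (pi *+ 2)^-1 by rewrite exprVn sqr_sqrtr// ltW.
rewrite -(integral_normal_pdf 0 s); apply: eq_integral => x _; congr EFin.
rewrite normal_pdfE// /normal_peak /normal_fun s2 subr0.
rewrite (_ : (pi *+ 2)^-1 * pi *+ 2 = 1 :> R); last first.
  by rewrite -mulrnAr mulVf// gt_eqF.
rewrite sqrtr1 invr1 mul1r; congr expR.
rewrite (_ : (pi *+ 2)^-1 *+ 2 = pi^-1 :> R).
  by rewrite invrK mulrC mulrN mulNr.
by rewrite -[LHS]mulr_natr -[pi *+ 2]mulr_natr invfM mulfVK ?pnatr_eq0.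
Qed.

Lemma iter_int_gweight n : iter_int setT (fun v : 'cV[R]_n => (gweight v)%:E) = 1%E.
Proof.
elim: n => [|n IH] /=.
  by rewrite /gweight /sqnorm big_ord0 mulr0 expR0.
rewrite -integral_gauss_pi; apply: eq_integral => x _.
rewrite -[RHS]mule1 -IH -iter_intZl ?lee_fin ?expR_ge0//; last 2 first.
- exact: vmeasurable_gweight.
- by move=> v; rewrite lee_fin gweight_ge0.
congr iter_int; apply/funext => v.
by rewrite (@gweight_col 1) EFinM /gweight {1}/sqnorm big_ord1 mxE.
Qed.

(* Marginalising out the directions orthogonal to the rows of [T]: the frame
   [row_mx T^T K] with [K] spanning [ker T] splits [gweight] as a product. The
   two unknown factors (Jacobian, integral over the kernel) cancel, as the
   case [F = 1] shows. *)
Lemma gaussian_projection m p (T : 'M[R]_(m, m + p)) (F : 'cV[R]_m -> \bar R) :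
  T *m T^T = 1%:M -> vmeasurable F -> (forall v, 0 <= F v)%E ->
  iter_int setT (fun z => F (T *m z) * (gweight z)%:E)%E =
  iter_int setT (fun v => F v * (gweight v)%:E)%E.
Proof.
move=> TT1 mF F0.
(* The relation [T *m T^T = 1] forces rank [m], so the kernel of [T] has dimension [p]; the columns
   of [K] form a basis of it, not necessarily orthonormal. *)
have [K [TK0 Kinj]] : exists K : 'M[R]_(m + p, p),
    T *m K = 0 /\ forall v : 'cV_p, K *m v = 0 -> v = 0.
  have rT : \rank (T^T) = m.
    apply/eqP; rewrite eqn_leq rank_leq_col/= -[X in (X <= _)%N](mxrank1 R).
    by rewrite -TT1 mxrankM_maxr.
  have rK : \rank (kermx T^T) = p by rewrite mxrank_ker rT addKn.
  exists (castmx (rK, erefl) (row_base (kermx T^T)))^T; split.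
    apply: trmx_inj; rewrite trmx_mul trmxK trmx0.
    by apply/sub_kermxP; rewrite eqmx_cast eq_row_base.
  move=> v /(congr1 trmx); rewrite trmx_mul trmxK trmx0 => vK.
  apply: trmx_inj; rewrite trmx0; apply: (row_free_inj _ (etrans vK (esym (mul0mx _ _)))).
  by rewrite row_free_castmx row_base_free.
pose Q : 'M[R]_(m + p) := row_mx T^T K.
have TQ (y1 : 'cV[R]_m) (y2 : 'cV[R]_p) : T *m (Q *m col_mx y1 y2) = y1.
  by rewrite mul_row_col mulmxDr !mulmxA TT1 TK0 mul0mx addr0 mul1mx.
(* If [Q] kills a vector, applying [T] shows that its upper part vanishes, and injectivity of [K]
   then kills the lower part. *)
have uQ : Q \in unitmx.
  rewrite -unitmx_tr -row_free_unit -kermx_eq0; apply/eqP/row_matrixP => i.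
  rewrite row0; set x := row i _.
  have : x *m Q^T = 0 by rewrite -row_mul mulmx_ker row0.
  move=> /(congr1 trmx); rewrite trmx_mul trmxK trmx0 => Qx.
  have := TQ (usubmx x^T) (dsubmx x^T).
  rewrite vsubmxK Qx mulmx0 => x1.
  move: Qx; rewrite -[x^T]vsubmxK -x1 mul_row_col mulmx0 add0r => /Kinj x2.
  by apply: trmx_inj; rewrite trmx0 -[x^T]vsubmxK -x1 x2 col_mx0.
have gQ (y1 : 'cV[R]_m) (y2 : 'cV[R]_p) :
    gweight (Q *m col_mx y1 y2) = gweight y1 * gweight (K *m y2).
  rewrite /gweight -expRD -mulrDr !sqnormE; congr (expR (_ * _)).
  have KT0 : K^T *m T^T = 0 by rewrite -trmx_mul TK0 trmx0.
  rewrite mul_row_col [(_ + _)^T]linearD /= mulmxDl !mulmxDr !trmx_mul trmxK !mulmxA.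
  rewrite -!(mulmxA y1^T) TT1 mul1mx TK0 mul0mx mulmx0 addr0.
  by rewrite -(mulmxA _ K^T) KT0 mulmx0 mul0mx add0r mxE.
have [c c0 cQ] := scales_iter_int_unitmx uQ.
pose C := iter_int setT (fun y : 'cV[R]_p => (gweight (K *m y))%:E).
have mK : vmeasurable (fun y : 'cV[R]_p => (gweight (K *m y))%:E).
  exact: vmeasurable_lin (@vmeasurable_gweight _).
have C0 : (0 <= C)%E by apply: iter_int_ge0 => v; rewrite lee_fin gweight_ge0.
have key (G : 'cV[R]_m -> \bar R) : vmeasurable G -> (forall v, 0 <= G v)%E ->
    (c%:E * iter_int setT (fun z => G (T *m z) * (gweight z)%:E) =
     C * iter_int setT (fun v => G v * (gweight v)%:E))%E.
  move=> mG G0; rewrite -cQ; last 2 first.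
  - by apply: vmeasurableM; [exact: vmeasurable_lin|exact: vmeasurable_gweight].
  - by move=> v; rewrite mule_ge0// lee_fin gweight_ge0.
  rewrite -iter_intZl//; last 2 first.
  - by apply: vmeasurableM; [exact: mG|exact: vmeasurable_gweight].
  - by move=> v; rewrite mule_ge0// lee_fin gweight_ge0.
  rewrite iter_int_split; congr iter_int; apply/funext => u.
  rewrite muleC -iter_intZl//; last 2 first.
  - by rewrite mule_ge0// lee_fin gweight_ge0.
  - by move=> v; rewrite lee_fin gweight_ge0.
  by congr iter_int; apply/funext => v; rewrite TQ gQ EFinM muleA.
(* For the constant function 1 both Gaussian masses are 1. In particular [C] is finite and nonzero,
   so it can be cancelled. *)
have cC : c%:E = C.
  have m1 : vmeasurable (fun _ : 'cV[R]_m => 1%E) by move=> d X u _; exact: measurable_cst.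
  have g1 n : (fun v : 'cV[R]_n => 1 * (gweight v)%:E)%E = (fun v => (gweight v)%:E).
    by apply/funext => v; rewrite mul1e.
  by have := key _ m1 (fun=> lee01); rewrite !g1 !iter_int_gweight !mule1.
have := key F mF F0; rewrite -cC => /(congr1 (fun x => c^-1%:E * x)%E).
by rewrite !muleA -!EFinM mulVf ?gt_eqF// !mul1e.
Qed.

End GaussianIntegral.

(** * From Borel sets of vectors to coordinatewise measurability *)

Section BorelFunctions.
Context {R : realType}.

(** Open cubes with rational centre and half-width: a countable base of the topology. *)
Let box {n} (z : 'cV[rat]_n * rat) : set 'cV[R]_n :=
  [set v | forall i, `|v i 0 - ratr (z.1 i 0)| < ratr z.2].

Let open_box n (U : set 'cV[R]_n) v : open U -> U v ->
  exists2 z, box z v & box z `<=` U.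
Proof.
move=> oU Uv; have /nbhs_ballP[e /= e0 eU] : nbhs v U by apply: open_nbhs_nbhs.
(* Two points of a cube of half-width below [e / 2] are within [e] of each other in each coordinate,
   by passing through the centre. *)
have [r] : exists r : rat, ratr r \in `]0, e / 2[ by apply: rat_in_itvoo; rewrite divr_gt0.
rewrite in_itv/= => /andP[r0 re].
have /fin_all_exists[q qP] i : exists q : rat, `|v i 0 - ratr q| < ratr r.
  have [q] : exists q : rat, ratr q \in `]v i 0 - ratr r, v i 0 + ratr r[.
    by apply: rat_in_itvoo; rewrite ltrBlDr -addrA ltrDl addr_gt0.
  by rewrite in_itv/= => qv; exists q; rewrite distrC ltr_distl.
exists (\col_i q i, r) => [i|w wz]; first by rewrite mxE.
apply: eU; split=> // i j; rewrite !ord1 /ball/=.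
have := wz i; rewrite mxE distrC => wq.
rewrite -[v i 0](subrK (ratr (q i))) -addrA (le_lt_trans (ler_normD _ _))//.
by rewrite (splitr e) ltrD// (lt_trans _ re).
Qed.

Let measurable_preimage_open d (T : measurableType d) n (u : T -> 'cV[R]_n) U :
  coord_measurable u -> open U -> measurable (u @^-1` U).
Proof.
move=> mu_ oU.
(* Cubes that leave [U] are replaced by the empty set, so that the union runs over a whole countable
   type. *)
pose W (z : 'cV[rat]_n * rat) := if `[< box z `<=` U >] then box z else set0.
have -> : u @^-1` U = \bigcup_z u @^-1` W z.
  apply/seteqP; split => [x /= Ux|x [z _]]; rewrite /= /W.
    by have [z zx zU] := open_box oU Ux; exists z => //=; rewrite /W asboolT.
  by case: asboolP => // zU; exact: zU.
apply: countable_bigcupT_measurable => [|z]; first exact: countableP.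
rewrite /W; case: asboolP => _; last by rewrite preimage_set0.
rewrite (_ : _ @^-1` _ = \big[setI/setT]_i
    (setT `&` (fun x => u x i 0) @^-1` ball (ratr (z.1 i 0) : R) (ratr z.2))).
  by apply: bigsetI_measurable => i _; apply: mu_ => //; exact: measurable_ball.
apply/seteqP; split => x.
  by move=> zx; rewrite -bigcap_seq => i _; split => //=; rewrite /ball/= distrC.
by rewrite -bigcap_seq => zx i; have [_ ] := zx i (mem_index_enum i); rewrite /ball/= distrC.
Qed.

(** The sets with measurable preimage under [u] form a sigma-algebra containing the open sets, hence
    all Borel sets. *)
Lemma vmeasurable_borel n (h : 'cV[R]_n -> R) :
  (forall B : set R, measurable B -> borel_cV (h @^-1` B)) ->
  vmeasurable (EFin \o h).
Proof.
move=> mh d T u mu_; apply/measurable_EFinP => _ B mB.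
suff sub : @borel_cV R n `<=` image_set_system setT u measurable by exact: sub (mh B mB).
apply: smallest_sub; first exact/sigma_algebra_image/sigma_algebra_measurable.
by move=> U oU; rewrite /image_set_system/= setTI; exact: measurable_preimage_open.
Qed.

End BorelFunctions.

(** * Orthogonality of products of plane rotations *)

Section OrthogonalMatrices.
Context {R : realType}.

Lemma orthogonalM n (A B : 'M[R]_n) :
  A *m A^T = 1%:M -> B *m B^T = 1%:M -> (A *m B) *m (A *m B)^T = 1%:M.
Proof. by move=> hA hB; rewrite trmx_mul mulmxA -(mulmxA A) hB mulmx1. Qed.

Lemma orthogonalV n (A : 'M[R]_n) : A *m A^T = 1%:M -> invmx A *m (invmx A)^T = 1%:M.
Proof.
move=> hA; have [uA _] := mulmx1_unit hA.
have -> : invmx A = A^T by rewrite -[LHS]mulmx1 -hA mulmxA mulVmx// mul1mx.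
by rewrite trmxK; exact: mulmx1C.
Qed.

(** Expanding rows in the standard basis reduces their inner products to Kronecker deltas. *)
Lemma row_rot_inv n (a : pair_t n) (t : R) p : is_pair a ->
  row p (rot_inv a t) =
  if p == a.1 then cos t *: delta_mx 0 a.1 + (- sin t) *: delta_mx 0 a.2
  else if p == a.2 then sin t *: delta_mx 0 a.1 + cos t *: delta_mx 0 a.2
  else delta_mx 0 p.
Proof.
case: a => a b; rewrite /is_pair/= => ab.
have ba : (b == a) = false by apply/eqP => e; rewrite e ltnn in ab.
have abF : (a == b) = false by rewrite eq_sym.
apply/rowP => q; rewrite !mxE /=.
have [->|pa] := eqVneq p a.
  rewrite abF !mxE /=.
  have [->|qa] := eqVneq q a; first by rewrite abF mulr1 mulr0 addr0.
  by have [_|qb] := eqVneq q b; rewrite mulr0 add0r ?mulr1 ?mulr0.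
have [->|pb] := eqVneq p b.
  rewrite !mxE /=.
  have [->|qa] := eqVneq q a; first by rewrite abF mulr1 mulr0 addr0.
  by have [_|qb] := eqVneq q b; rewrite mulr0 add0r ?mulr1 ?mulr0.
by rewrite !mxE eqxx /= eq_sym; case: eqP.
Qed.

Lemma rot_inv_orthogonal n (a : pair_t n) (t : R) : is_pair a ->
  rot_inv a t *m (rot_inv a t)^T = 1%:M.
Proof.
move=> ha; apply/matrixP => p q.
have -> : (rot_inv a t *m (rot_inv a t)^T) p q =
    (row p (rot_inv a t) *m (row q (rot_inv a t))^T) 0 0.
  by rewrite !mxE; apply: eq_bigr => i _; rewrite !mxE.
have D i j : (delta_mx 0 i *m (delta_mx 0 j)^T : 'M[R]_1) = (i == j)%:R%:M.
  apply/matrixP => k l; rewrite trmx_delta mul_delta_mx_cond !ord1.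
  by case: (i == j); rewrite !mxE.
have ba : (a.2 == a.1) = false.
  by apply/eqP => e; move: ha; rewrite /is_pair e ltnn.
rewrite !row_rot_inv// [RHS]mxE.
have TD (x y : 'rV[R]_n) : (x + y)^T = x^T + y^T by exact: linearD.
have TZ c (x : 'rV[R]_n) : (c *: x)^T = c *: x^T by exact: linearZ.
have abF : (a.1 == a.2) = false by rewrite eq_sym.
have sc : sin t * sin t = 1 - cos t * cos t by rewrite -!expr2 sin2cos2.
(* Nine cases, as [p] and [q] are each [a.1], [a.2] or another index; those with [p] outside the
   rotation plane close at once. *)
have [->|pa] := eqVneq p a.1; [|have [->|pb] := eqVneq p a.2];
 (have [qa|qa] := eqVneq q a.1; [rewrite ?qa|have [qb|qb] := eqVneq q a.2; [rewrite ?qb|]]);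
 rewrite /= ?eqxx ?ba ?abF ?(negbTE pa) ?(negbTE pb) /= ?(TD, TZ, mulmxDl, mulmxDr, D);
 rewrite -?scalemxAl -?scalemxAr ?D ?eqxx ?ba ?abF ?[a.1 == q]eq_sym ?[a.2 == q]eq_sym;
 rewrite ?(negbTE pa) ?(negbTE pb) ?mxE ?eqxx /= ?mulr1n ?(mulr0, mulr1, addr0, add0r)//.
- by rewrite mulrNN sc addrC subrK.
- by rewrite mulNr mulrC subrr.
- by rewrite (negbTE qa) (negbTE qb) !mulr0 addr0.
- by rewrite mulrN mulrC subrr.
- by rewrite sc subrK.
- by rewrite (negbTE qa) (negbTE qb) !mulr0 addr0.
Qed.

Lemma prod_rot_inv_orthogonal M N k (a : {ffun 'I_k -> pair_t (M + N)}) (t : 'cV[R]_k) :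
  [forall l, is_pair (a l)] -> prod_rot_inv a t *m (prod_rot_inv a t)^T = 1%:M.
Proof.
move=> /forallP ha; apply: orthogonalV.
apply: (big_ind (fun A : 'M[R]_(M + N) => A *m A^T = 1%:M)).
- by rewrite trmx1 mulmx1.
- by move=> A B; exact: orthogonalM.
- by move=> l _; apply/orthogonalV/rot_inv_orthogonal/ha.
Qed.

End OrthogonalMatrices.

(** * Gaussian averages along the blocks of an orthogonal matrix *)

Section Contraction.
Context {R : realType}.

(** A centred Gaussian image depends only on its covariance. Here [T] has orthonormal rows and
    [diag_mx s *m T = row_mx 0 B], so averaging [F] composed with [diag_mx s] along [T] yields both
    sides. *)
Lemma gaussian_image_diag m n (B : 'M[R]_(m, n)) (s : 'rV[R]_m) (F : 'cV[R]_m -> \bar R) :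
  B *m B^T = diag_mx (\row_j s 0 j ^+ 2) -> vmeasurable F -> (forall v, 0 <= F v)%E ->
  iter_int setT (fun w => F (B *m w) * (gweight w)%:E)%E =
  iter_int setT (fun w => F (diag_mx s *m w) * (gweight w)%:E)%E.
Proof.
move=> BB mF F0.
(* Since [0^-1 = 0], [D] inverts only the nonzero [s 0 j]. The [m] extra coordinates, through [E],
   supply unit rows where [s 0 j = 0]. *)
pose D := diag_mx (\row_j (s 0 j)^-1); pose E := diag_mx (\row_j (s 0 j == 0)%:R : 'rV[R]_m).
pose T : 'M[R]_(m, m + n) := row_mx E (D *m B).
have TT1 : T *m T^T = 1%:M.
  rewrite tr_row_mx mul_row_col trmx_mul !tr_diag_mx mulmxA -(mulmxA D) BB !mulmx_diag.
  rewrite -linearD -diag_const_mx; congr diag_mx; apply/rowP => j; rewrite !mxE.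
  have [s0|sj] := eqVneq (s 0 j) 0; first by rewrite s0 invr0 mulr0 addr0 mulr1.
  by rewrite /= mulr0 add0r expr2 mulrA mulVf// mul1r divff.
(* Where [s 0 i = 0], the diagonal of [BB] says that row [i] of [B] has squared norm zero. *)
have EB : E *m B = 0.
  apply/matrixP => i j; rewrite mul_diag_mx !mxE.
  have [si|] := eqVneq (s 0 i) 0; last by rewrite mul0r.
  have /eqP := congr1 (fun X : 'M[R]_m => X i i) BB.
  rewrite !mxE eqxx mulr1n si expr0n /= psumr_eq0; last first.
    by move=> k _; rewrite mxE -expr2 sqr_ge0.
  move=> /allP/(_ j (mem_index_enum j)); rewrite mxE /= -expr2 sqrf_eq0 => /eqP ->.
  by rewrite mulr0.
have ST : diag_mx s *m T = row_mx 0 B.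
  rewrite mul_mx_row mulmx_diag; congr row_mx.
    apply/matrixP => i j; rewrite !mxE.
    by have [s0|_] := eqVneq (s 0 i) 0; rewrite ?s0 /= ?mulr0n ?mul0r ?mulr0 mul0rn.
  rewrite -[RHS]subr0 -EB -[X in X - _]mul1mx -mulmxBl mulmxA mulmx_diag; congr (_ *m _).
  rewrite -diag_const_mx -linearB; congr diag_mx; apply/rowP => j; rewrite !mxE.
  by have [s0|sj] := eqVneq (s 0 j) 0; rewrite ?s0 ?invr0 ?mul0r ?subrr// divff// subr0.
have mS : vmeasurable (fun v => F (diag_mx s *m v)) by exact: vmeasurable_lin.
rewrite -(gaussian_projection TT1 mS)// iter_int_split.
set K := LHS.
have K0 : (0 <= K)%E.
  by apply: iter_int_ge0 => v; rewrite mule_ge0// lee_fin gweight_ge0.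
(* The extra coordinates contribute a Gaussian mass 1, inserted here as a factor of [K]. *)
rewrite -[K]mule1 -(iter_int_gweight m) -iter_intZl//; last 2 first.
- exact: vmeasurable_gweight.
- by move=> v; rewrite lee_fin gweight_ge0.
congr iter_int; apply/funext => u.
rewrite muleC -iter_intZl//; last 3 first.
- by rewrite lee_fin gweight_ge0.
- apply: vmeasurableM; last exact: vmeasurable_gweight.
  exact: vmeasurable_lin.
- by move=> v; rewrite mule_ge0// lee_fin gweight_ge0.
congr iter_int; apply/funext => w.
by rewrite mulmxA ST mul_row_col mul0mx add0r gweight_col EFinM muleCA.
Qed.

(** With [A], [B] the upper blocks of [O] and [G = diag_mx gam],
    [A v + B w = U (G V^T v + U^T B w)]. Both sides thus average the same [F], along [U^T B] and
    along the square root of [1 - G^2]. *)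
Lemma gaussian_block_svd m n (O : 'M[R]_(m + n)) (U V : 'M[R]_m) (gam : 'rV[R]_m)
    (h : 'cV[R]_m -> R) (v : 'cV[R]_m) :
  O *m O^T = 1%:M -> U *m U^T = 1%:M -> V *m V^T = 1%:M ->
  (forall j, 0 <= gam 0 j <= 1) -> ulsubmx O = U *m diag_mx gam *m V^T ->
  vmeasurable (EFin \o h) -> (forall v, 0 <= h v) ->
  iter_int setT (fun w : 'cV[R]_n => (h (usubmx (O *m col_mx v w)) * gweight w)%:E) =
  iter_int setT (fun w : 'cV[R]_m =>
    (h (U *m (diag_mx gam *m V^T *m v
         + diag_mx (\row_j Num.sqrt (1 - gam 0 j ^+ 2)) *m w)) * gweight w)%:E).
Proof.
move=> O1 U1 V1 g01 svd mh h0.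
pose F y := (h (U *m (diag_mx gam *m V^T *m v + y)))%:E.
pose s := \row_j Num.sqrt (1 - gam 0 j ^+ 2).
have U1' := mulmx1C U1; have V1' := mulmx1C V1.
have BB : (U^T *m ursubmx O) *m (U^T *m ursubmx O)^T = diag_mx (\row_j s 0 j ^+ 2).
  have : ulsubmx O *m (ulsubmx O)^T + ursubmx O *m (ursubmx O)^T = 1%:M.
    have := congr1 ulsubmx O1.
    by rewrite -[in LHS](submxK O) tr_block_mx mulmx_block block_mxKul
      (scalar_mx_block m n) block_mxKul.
  rewrite svd !trmx_mul !trmxK tr_diag_mx => /(canRL (addKr _)) BB.
  rewrite mulmxA -(mulmxA U^T) BB mulmxDr mulmxDl mulmx1 U1' mulmxN mulNmx !mulmxA U1' mul1mx.
  rewrite -(mulmxA (diag_mx gam) V^T) V1' mulmx1 -mulmxA U1' mulmx1 mulmx_diag.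
  rewrite addrC -diag_const_mx -linearB; congr diag_mx; apply/rowP => j; rewrite !mxE.
  (* The bounds on [gam] keep the radicand nonnegative, where [Num.sqrt] is a true square root. *)
  by rewrite sqr_sqrtr ?expr2// subr_ge0 -expr2 expr_le1; have /andP[] := g01 j.
have mF : vmeasurable F.
  rewrite (_ : F = (fun y => (EFin \o h) (U *m y + U *m (diag_mx gam *m V^T *m v)))).
    exact: vmeasurable_affine.
  by apply/funext => y; rewrite /F /= mulmxDr addrC.
rewrite -(gaussian_image_diag BB mF); last by move=> y; rewrite lee_fin.
congr iter_int; apply/funext => w; rewrite /F -EFinM; congr (h _ * _)%:E.
by rewrite -[in LHS](submxK O) mul_block_col col_mxKu svd mulmxDr !mulmxA U1 mul1mx.
Qed.

End Contraction.

Unset Implicit Arguments.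

Theorem theorem3p2 (R : realType) (M N : nat) (lS lR mu : R)
  (rho : R -> R) (h0 : 'cV[R]_M -> R) :
  (0 < M)%N -> (0 < N)%N -> 0 < lS -> 0 < lR -> 0 < mu ->
  (* rho is a probability density on [-pi, pi] *)
  measurable_fun `[(- pi)%R, pi%R] rho ->
  (forall x, x \in `[(- pi)%R, pi%R] -> 0 <= rho x) ->
  (\int[@lebesgue_measure R]_(x in `[(- pi)%R, pi%R]) (rho x)%:E = 1)%E ->
  (* h0 >= 0 and h0(v) e^{-pi|v|^2} is a probability density on R^M *)
  (forall v, 0 <= h0 v) ->
  (forall B : set R, measurable B -> borel_cV (h0 @^-1` B)) ->
  iter_int setT (fun v : 'cV[R]_M => (h0 v * gweight v)%:E) = 1%E ->
  forall (k : nat)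
    (U V : {ffun 'I_k -> pair_t (M + N)} -> 'cV[R]_k -> 'M[R]_M)
    (gam : {ffun 'I_k -> pair_t (M + N)} -> 'cV[R]_k -> 'rV[R]_M),
  (* A_k = U_k Gamma_k V_k^T is a singular value decomposition *)
  (forall (a : {ffun 'I_k -> pair_t (M + N)}) (t : 'cV[R]_k), [forall l, is_pair (a l)] ->
     (forall l, t l 0 \in `[(- pi)%R, pi%R]) ->
     [/\ U a t *m (U a t)^T = 1%:M /\ (U a t)^T *m U a t = 1%:M,
         V a t *m (V a t)^T = 1%:M /\ (V a t)^T *m V a t = 1%:M,
         (forall j, 0 <= gam a t 0 j <= 1) &
         A_blk a t = U a t *m diag_mx (gam a t) *m (V a t)^T]) ->
  forall v : 'cV[R]_M,
  h_k N lS lR mu rho h0 k v =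
  (\sum_(a : {ffun 'I_k -> pair_t (M + N)} | [forall l, is_pair (a l)])
     (\prod_(l < k) lam lS lR mu (a l))%:E *
     iter_int `[(- pi)%R, pi%R] (fun t : 'cV[R]_k =>
        (\prod_(l < k) rho (t l 0))%:E *
        iter_int setT (fun w : 'cV[R]_M =>
          (h0 (U a t *m (diag_mx (gam a t) *m (V a t)^T *m v
                + diag_mx (\row_j Num.sqrt (1 - gam a t 0 j ^+ 2)) *m w))
           * gweight w)%:E)))%E.
Proof.
move=> _ _ _ _ _ _ _ _ h0_ge0 mh0 _ k U V gam svd v.
(* The sums and the angle integrals match term by term, which leaves the innermost integrals at
   fixed pairs and angles. *)
apply: eq_bigr => a pa; congr (_ * _)%E.
apply: eq_iter_int => t tpi; congr (_ * _)%E.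
have tpi' l : t l 0 \in `[(- pi)%R, pi%R] by have := tpi l; rewrite inE.
have [[U1 _] [V1 _] g01 Ak] := svd a t pa tpi'.
apply: gaussian_block_svd => //; first exact: prod_rot_inv_orthogonal.
exact: vmeasurable_borel.
Qed.
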